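(* Let $\mathcal H$ be a separable Hilbert space and let $S:\mathcal H\to\mathcal H$ be a bounded, self-adjoint, positive definite operator (with bounded inverse $S^{-1}$). Let $S_1,S_2:\mathcal H\to\mathcal H$ be bounded, self-adjoint and positive semidefinite with $S=S_1+S_2$. Then for any $\lambda\in\mathbb R$, $$0\le S_1-S_1S^{-1}S_1\le(\lambda-1)\, S_2+\left(1-\frac{\lambda}{2}\right)^2 S.$$
   Context: For operators $U,V:\mathcal H\to\mathcal H$, write $U\le V$ if $U,V$ are self-adjoint and $V-U$ is positive semidefinite, i.e. $\langle (V-U)f,f\rangle\ge 0$ for all $f\in\mathcal H$. Positive definite operators are understood to be boundedly invertible. Hilbert spaces are complex. *)

(* Defs.v *)
From HB Require Import structures.
From mathcomp Require Import all_boot all_order all_algebra.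
From mathcomp Require Import complex.
From mathcomp Require Import all_classical all_reals all_analysis.
Set Implicit Arguments.
Unset Strict Implicit.
Unset Printing Implicit Defensive.
Import Order.TTheory GRing.Theory Num.Theory numFieldNormedType.Exports.
Local Open Scope ring_scope.
Local Open Scope classical_set_scope.
Local Open Scope complex_scope.

(* A complex Hilbert space: a complete normed space over R[i] whose norm is
   induced by an inner product, which is linear in its first argument and
   conjugate-linear in its second. *)
HB.mixin Record isHilbert (R : realType) H of CompleteNormedModule R[i] H := {
  hdot : {dot H for Num.conj} ;
  sqr_hnormE : forall x : H, `|x| ^+ 2 = hdot x x
}.

#[short(type="hilbertType")]
HB.structure Definition Hilbert (R : realType) :=
  {H of isHilbert R H & CompleteNormedModule R[i] H}.

Notation "⟨ x , y ⟩" := (hdot x y)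
  (at level 0, x at level 200, y at level 200, format "⟨ x ,  y ⟩").

Definition separable (T : topologicalType) :=
  exists2 D : set T, countable D & dense D.

Section operators.
Context {R : realType} {H : hilbertType R}.
Implicit Types U V : {linear H -> H}.

(* See linear_boundedP for the equivalence with |U f| <= M |f|. *)
Definition bounded_op U := bounded_near U (nbhs (0 : H)).

Definition selfadjoint U := forall f g : H, ⟨U f, g⟩ = ⟨f, U g⟩.

(* On R[i], 0 <= z and 0 < z entail that z is real. *)
Definition psd U := forall f : H, 0 <= ⟨U f, f⟩.

Definition bounded_inverse U V :=
  [/\ bounded_op V, cancel U V & cancel V U].

Definition boundedly_invertible U := exists V, bounded_inverse U V.

Definition posdef U :=
  (forall f : H, f != 0 -> 0 < ⟨U f, f⟩) /\ boundedly_invertible U.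

Definition op_le U V := [/\ selfadjoint U, selfadjoint V & psd (V \- U)].

End operators.

(* Main.v *)
Require Import Defs.
From HB Require Import structures.
From mathcomp Require Import all_boot all_order all_algebra.
From mathcomp Require Import complex.
From mathcomp Require Import all_classical all_reals all_analysis.
From mathcomp Require Import ring.
Import Order.TTheory GRing.Theory Num.Theory numFieldNormedType.Exports.
Local Open Scope ring_scope.
Local Open Scope complex_scope.

(** Fix [f] and put [g := S^-1 S1 f], so that [S g = S1 f].  The quadratic form
    of [S1 - S1 S^-1 S1] at [f] is then [⟨S1 f, f⟩ - ⟨S1 g, f⟩], where
    [⟨S1 g, f⟩ = ⟨g, S1 f⟩ = ⟨S g, g⟩] is real, and both bounds come from
    writing a difference as a manifestly nonnegative expression.

    - Lower bound: splitting [S g = S1 f] as [S1 g + S2 g] gives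
      [⟨S1 f, f⟩ - ⟨S1 g, f⟩ = ⟨S1 (f - g), f - g⟩ + ⟨S2 g, g⟩]
      ([schur_gap_split]).

    - Upper bound: since [S2 = S - S1], the right-hand operator equals
      [(λ/2)^2 S - λ S1 + S1].  The gap to [S1 - S1 S^-1 S1] is therefore
      [(λ/2)^2 S - λ S1 + S1 S^-1 S1], a perfect square for the form of [S]: its
      value at [f] is [⟨S h, h⟩] with [h = g - (λ/2) f] ([schur_square]). *)

Section Schur.
Context {R : realType} {H : hilbertType R}.
Implicit Types (U V : {linear H -> H}) (f g h : H) (a : R).

(** The bilinearity rules are stated for [hdot] itself so that, after rewriting,
    the terms are syntactically inner products again and the hypotheses of
    self-adjointness apply to them. *)
Lemma hdotDl f g h : ⟨f + g, h⟩ = ⟨f, h⟩ + ⟨g, h⟩.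
Proof. exact: linearDl. Qed.

Lemma hdotDr f g h : ⟨f, g + h⟩ = ⟨f, g⟩ + ⟨f, h⟩.
Proof. exact: linearDr. Qed.

Lemma hdotBl f g h : ⟨f - g, h⟩ = ⟨f, h⟩ - ⟨g, h⟩.
Proof. exact: linearBl. Qed.

Lemma hdotBr f g h : ⟨f, g - h⟩ = ⟨f, g⟩ - ⟨f, h⟩.
Proof. exact: linearBr. Qed.

Lemma hdotZl (z : R[i]) f g : ⟨z *: f, g⟩ = z * ⟨f, g⟩.
Proof. exact: linearZl_LR. Qed.

Lemma hdotZr_real a f g : ⟨f, a%:C *: g⟩ = a%:C * ⟨f, g⟩.
Proof. by rewrite linearZr_LR /=; congr (_ * _); exact: conjc_real. Qed.

Lemma selfadjoint0 : selfadjoint (\0 : {linear H -> H}).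
Proof. by move=> f g /=; rewrite linear0l linear0r. Qed.

Lemma selfadjointD U V : selfadjoint U -> selfadjoint V -> selfadjoint (U \+ V).
Proof. by move=> hU hV f g /=; rewrite hdotDl hdotDr hU hV. Qed.

Lemma selfadjointB U V : selfadjoint U -> selfadjoint V -> selfadjoint (U \- V).
Proof. by move=> hU hV f g /=; rewrite hdotBl hdotBr hU hV. Qed.

Lemma selfadjointZ a U : selfadjoint U -> selfadjoint (a%:C \*: U).
Proof. by move=> hU f g /=; rewrite hdotZl hdotZr_real hU. Qed.

Lemma selfadjoint_can U V : cancel V U -> selfadjoint U -> selfadjoint V.
Proof. by move=> VK hU f g; rewrite -[in RHS](VK f) hU VK. Qed.

Lemma selfadjoint_sandwich U V :
  selfadjoint U -> selfadjoint V -> selfadjoint (U \o V \o U).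
Proof. by move=> hU hV f g /=; rewrite hU hV hU. Qed.

Lemma psdD U V : psd U -> psd V -> psd (U \+ V).
Proof. by move=> hU hV f /=; rewrite hdotDl addr_ge0. Qed.

(** In the expansion of [⟨S1 (f - g), f - g⟩] the cross term [⟨S1 f, g⟩] equals
    [⟨S1 g, g⟩ + ⟨S2 g, g⟩], which cancels the two terms quadratic in [g]. *)
Lemma schur_gap_split (S1 S2 : {linear H -> H}) f g :
  S1 g + S2 g = S1 f ->
  ⟨S1 f, f⟩ - ⟨S1 g, f⟩ = ⟨S1 (f - g), f - g⟩ + ⟨S2 g, g⟩.
Proof.
move=> gE.
have cross : ⟨S1 f, g⟩ = ⟨S1 g, g⟩ + ⟨S2 g, g⟩ by rewrite -gE hdotDl.
by rewrite (linearB S1) hdotBl !hdotBr cross; ring.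
Qed.

(** Both cross terms of the square equal [⟨S1 f, f⟩]: they are [⟨S g, f⟩] and
    [⟨S f, g⟩ = ⟨f, S g⟩], with [S g = S1 f].  The remaining term [⟨S g, g⟩] is
    [⟨g, S1 f⟩ = ⟨S1 g, f⟩]. *)
Lemma schur_square (S S1 : {linear H -> H}) f g a :
  selfadjoint S -> selfadjoint S1 -> S g = S1 f ->
  ⟨S (g - a%:C *: f), g - a%:C *: f⟩ =
    (a ^+ 2)%:C * ⟨S f, f⟩ - (2 * a)%:C * ⟨S1 f, f⟩ + ⟨S1 g, f⟩.
Proof.
move=> hS h1 gE.
have cross : ⟨S f, g⟩ = ⟨S1 f, f⟩ by rewrite hS gE h1.
have sqE : ⟨S g, g⟩ = ⟨S1 g, f⟩ by rewrite hS gE h1.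
rewrite (linearB S) (linearZ_LR S) hdotBl !hdotBr /= !hdotZl !hdotZr_real.
rewrite cross sqE gE !rmorphM rmorph_nat /=; ring.
Qed.

End Schur.

Theorem theorem2p5 (R : realType) (H : hilbertType R)
    (S Sinv S1 S2 : {linear H -> H}) :
  separable H ->
  bounded_op S -> selfadjoint S -> posdef S -> bounded_inverse S Sinv ->
  bounded_op S1 -> selfadjoint S1 -> psd S1 ->
  bounded_op S2 -> selfadjoint S2 -> psd S2 ->
  S =1 S1 \+ S2 ->
  forall lambda : R,
    op_le \0 (S1 \- (S1 \o Sinv \o S1)) /\
    op_le (S1 \- (S1 \o Sinv \o S1))
      (((lambda - 1)%:C \*: S2) \+ (((1 - lambda / 2) ^+ 2)%:C \*: S)).
Proof.
move=> _ _ saS _ [_ _ SinvK] _ sa1 psd1 _ sa2 psd2 SE lambda.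
have saT : selfadjoint (S1 \- (S1 \o Sinv \o S1)).
  apply: selfadjointB => //; apply: selfadjoint_sandwich => //.
  exact: selfadjoint_can saS.
have psdS : psd S by move=> f; rewrite SE; exact: psdD.
split; split=> //.
- exact: selfadjoint0.
- move=> f /=; rewrite subr0 hdotBl /=.
  rewrite (@schur_gap_split _ _ S1 S2) ?addr_ge0 //.
  by rewrite -[LHS]SE SinvK.
- by apply: selfadjointD; exact: selfadjointZ.
- move=> f /=; have gE := SinvK (S1 f).
  suff -> : ⟨(lambda - 1)%:C *: S2 f + ((1 - lambda / 2) ^+ 2)%:C *: S f
             - (S1 f - S1 (Sinv (S1 f))), f⟩ =
      ⟨S (Sinv (S1 f) - (lambda / 2)%:C *: f),
        Sinv (S1 f) - (lambda / 2)%:C *: f⟩ by exact: psdS.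
  (* Eliminating [S2] turns both sides into combinations of [⟨S f, f⟩],
     [⟨S1 f, f⟩] and [⟨S1 g, f⟩], where [g := Sinv (S1 f)]. *)
  have -> : S2 f = S f - S1 f by rewrite SE /= addrC addKr.
  rewrite (@schur_square _ _ S S1) // !hdotBl !hdotDl /= !hdotZl !hdotBl.
  have -> : (1 - lambda / 2) ^+ 2 = (lambda / 2) ^+ 2 + 1 - lambda by field.
  have -> : 2 * (lambda / 2) = lambda by field.
  rewrite !rmorphB rmorphD rmorph1 /=; ring.
Qed.
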